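(* Let $P\subset M_{\mathbb{R}}$ be a full-dimensional generalized Delzant polytope. Then for all sufficiently large positive real numbers $\lambda$ the polytope $\lambda P$ is canonically closed.
   Context: $M\cong\mathbb{Z}^d$ is a lattice, $N=\mathrm{Hom}(M,\mathbb{Z})$ its dual, $\langle\cdot,\cdot\rangle$ the natural pairing, extended to $M_{\mathbb{R}}$ and $N_{\mathbb{R}}$. For a compact convex set $\square\subset M_{\mathbb{R}}$ put $\mathrm{Min}_\square(y)=\min_{x\in\square}\langle x,y\rangle$, $y\in N_{\mathbb{R}}$. A compact convex polytope $P\subset M_{\mathbb{R}}$ of dimension $\le d$ is a generalized Delzant polytope if there are finitely many lattice vectors $\nu_1,\dots,\nu_s\in N$ and real numbers $\delta_1,\dots,\delta_s$ with $P=\{x\in M_{\mathbb{R}}\mid\langle x,\nu_i\rangle\ge\delta_i,\ 1\le i\le s\}$. For a full-dimensional generalized Delzant polytope $P$: the Fine interior is $F(P)=\{x\in M_{\mathbb{R}}\mid \langle x,\nu\rangle\ge \mathrm{Min}_P(\nu)+1\ \forall \nu\in N\setminus\{0\}\}$. If $F(P)\ne\emptyset$, the support of the Fine interior is $S_F(P)=\{\nu\in N\setminus\{0\}\mid \mathrm{Min}_{F(P)}(\nu)=\mathrm{Min}_P(\nu)+1\}$ and the canonical hull is $C(P)=\{x\in M_{\mathbb{R}}\mid \langle x,\nu\rangle\ge\mathrm{Min}_P(\nu)\ \forall\nu\in S_F(P)\}$. $P$ is called canonically closed if $F(P)\ne\emptyset$ and $C(P)=P$. *)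

(* Defs.v *)
From HB Require Import structures.
From mathcomp Require Import all_boot all_order all_algebra.
From mathcomp Require Import all_classical all_reals all_analysis.

Set Implicit Arguments.
Unset Strict Implicit.
Unset Printing Implicit Defensive.

Import Order.TTheory GRing.Theory Num.Theory.
Import numFieldNormedType.Exports.

Local Open Scope classical_set_scope.
Local Open Scope ring_scope.

(** A basis of the lattice is fixed: [M] is ['rV[int]_d], [M_R] is ['rV[R]_d],
    and the dual objects are columns, [N = 'cV[int]_d] and [N_R = 'cV[R]_d],
    a column [y] being the linear form [x |-> x *m y]. *)
Definition pairing (R : realType) (d : nat)
    (x : 'rV[R]_d) (y : 'cV[R]_d) : R := (x *m y) 0 0.

Definition toNR (R : realType) (d : nat) (nu : 'cV[int]_d) : 'cV[R]_d :=
  map_mx (fun z : int => z%:~R) nu.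

(** The infimum is attained, hence a minimum, when [A] is nonempty and compact;
    [inf] takes the junk value 0 when [A] is empty. *)
Definition Min (R : realType) (d : nat)
    (A : set 'rV[R]_d) (y : 'cV[R]_d) : R := inf [set pairing x y | x in A].

(** A compact set cut out by finitely many half-spaces is a convex polytope, so
    no separate polytope hypothesis is needed. *)
Definition generalized_Delzant (R : realType) (d : nat)
    (P : set 'rV[R]_d) : Prop :=
  compact P /\
  exists (s : nat) (nu : 'I_s -> 'cV[int]_d) (delta : 'I_s -> R),
    P = [set x | forall i : 'I_s, delta i <= pairing x (toNR R (nu i))].

Definition affine_hull (R : realType) (d : nat)
    (A : set 'rV[R]_d) : set 'rV[R]_d :=
  [set x | exists (n : nat) (c : 'I_n -> R) (p : 'I_n -> 'rV[R]_d),
     [/\ forall i, A (p i), \sum_(i < n) c i = 1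
       & x = \sum_(i < n) c i *: p i]].

Definition full_dimensional (R : realType) (d : nat)
    (P : set 'rV[R]_d) : Prop := affine_hull P = setT.

Definition Fine_interior (R : realType) (d : nat)
    (P : set 'rV[R]_d) : set 'rV[R]_d :=
  [set x | forall nu : 'cV[int]_d, nu != 0 ->
     Min P (toNR R nu) + 1 <= pairing x (toNR R nu)].

Definition Fine_support (R : realType) (d : nat)
    (P : set 'rV[R]_d) : set 'cV[int]_d :=
  [set nu | nu != 0 /\
     Min (Fine_interior P) (toNR R nu) = Min P (toNR R nu) + 1].

Definition canonical_hull (R : realType) (d : nat)
    (P : set 'rV[R]_d) : set 'rV[R]_d :=
  [set x | forall nu : 'cV[int]_d, Fine_support P nu ->
     Min P (toNR R nu) <= pairing x (toNR R nu)].

Definition canonically_closed (R : realType) (d : nat)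
    (P : set 'rV[R]_d) : Prop :=
  Fine_interior P !=set0 /\ canonical_hull P = P.

Definition dilate (R : realType) (d : nat)
    (lambda : R) (P : set 'rV[R]_d) : set 'rV[R]_d :=
  [set lambda *: x | x in P].

(* Main.v *)
Require Import Defs.
From HB Require Import structures.
From mathcomp Require Import all_boot all_order all_algebra.
From mathcomp Require Import all_classical all_reals all_analysis.
From mathcomp Require Import ring lra zify.

(* Choose an irredundant system of inequalities for P. Each inequality defines
   a facet with primitive normal nu having a point p where no other inequality
   is tight: the segment from an interior point to a point violating only this
   inequality crosses the facet at such a p. Pick a lattice vector u with
   <u, nu> = 1. For large lambda the point c = lambda p + u lies in
   F(lambda P): with k = <u, mu>, the inequality for mu is clear if k >= 1, and
   if k <= 0 it follows by comparing p with the points p + e v of P, where v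
   runs over finitely many lattice vectors with <v, nu> = 1, as the integers
   <v, mu> are not all nonnegative. Since <c, nu> = Min_(lambda P)(nu) + 1, nu
   belongs to the support of F(lambda P), so every inequality of P is recovered
   in the canonical hull. *)

Import Order.TTheory GRing.Theory Num.Theory.
Import numFieldNormedType.Exports.

Local Open Scope classical_set_scope.
Local Open Scope ring_scope.

(** * Pairings, minima and dilates *)

Lemma pairingDl (R : realType) (d : nat) (x x' : 'rV[R]_d) (y : 'cV[R]_d) :
  pairing (x + x') y = pairing x y + pairing x' y.
Proof. by rewrite /pairing mulmxDl mxE. Qed.

Lemma pairingZl (R : realType) (d : nat) (a : R) (x : 'rV[R]_d)
  (y : 'cV[R]_d) : pairing (a *: x) y = a * pairing x y.
Proof. by rewrite /pairing -scalemxAl mxE. Qed.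

Lemma pairingZr (R : realType) (d : nat) (a : R) (x : 'rV[R]_d)
  (y : 'cV[R]_d) : pairing x (a *: y) = a * pairing x y.
Proof. by rewrite /pairing -scalemxAr mxE. Qed.

Lemma pairing_sumZl (R : realType) (d n : nat) (c : 'I_n -> R)
  (p : 'I_n -> 'rV[R]_d) (y : 'cV[R]_d) :
  pairing (\sum_(i < n) c i *: p i) y = \sum_(i < n) c i * pairing (p i) y.
Proof.
rewrite /pairing mulmx_suml summxE; apply: eq_bigr => i _.
by rewrite -scalemxAl mxE.
Qed.

Lemma pairing_int (R : realType) (d : nat) (v : 'rV[int]_d) (nu : 'cV[int]_d) :
  pairing (map_mx intr v) (toNR R nu) = ((v *m nu) 0 0)%:~R.
Proof. by rewrite /pairing /toNR -map_mxM mxE. Qed.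

(** Compactness bounds every coordinate. This is what makes the [inf] in [Min] a genuine lower
    bound. *)
Lemma compact_pairing_has_lbound (R : realType) (d : nat) (P : set 'rV[R]_d)
  (y : 'cV[R]_d) : compact P -> has_lbound [set pairing x y | x in P].
Proof.
move=> cP.
have [M [_ HM]] := compact_bounded cP.
have {}HM x : P x -> forall j, `|x 0 j| <= M + 1.
  have M1 : M < M + 1 by rewrite ltrDl.
  move=> Px j; have := HM _ M1 x Px.
  by apply: le_trans; rewrite /Num.norm/= mx_normrE; apply: (le_bigmax _ _ (0, j)).
exists (- \sum_j (M + 1) * `|y j 0|) => _ [x Px <-].
rewrite lerNl /pairing mxE -sumrN; apply: ler_sum => j _.
apply: le_trans (ler_norm _) _; rewrite normrN normrM.
by apply: ler_wpM2r => //; apply: HM.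
Qed.

Lemma Min_le (R : realType) (d : nat) (P : set 'rV[R]_d) (y : 'cV[R]_d)
  (x : 'rV[R]_d) :
  has_lbound [set pairing x y | x in P] -> P x -> Min P y <= pairing x y.
Proof. by move=> lb Px; apply: ge_inf => //; exists x. Qed.

Lemma Min_attained (R : realType) (d : nat) (P : set 'rV[R]_d) (y : 'cV[R]_d)
  (x : 'rV[R]_d) :
  P x -> (forall z, P z -> pairing x y <= pairing z y) ->
  Min P y = pairing x y.
Proof.
move=> Px xmin.
have lb : lbound [set pairing x y | x in P] (pairing x y).
  by move=> _ [z Pz <-]; apply: xmin.
apply/eqP; rewrite eq_le; apply/andP; split.
  by apply: Min_le => //; exists (pairing x y).
by apply: lb_le_inf => //; exists (pairing x y); exists x.
Qed.

Lemma dilate_pairing_has_lbound (R : realType) (d : nat) (P : set 'rV[R]_d)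
  (lambda : R) (y : 'cV[R]_d) : compact P -> 0 <= lambda ->
  has_lbound [set pairing x y | x in dilate lambda P].
Proof.
move=> cP l0; have [m mP] := @compact_pairing_has_lbound _ _ _ y cP.
exists (lambda * m) => _ [_ [x Px <-] <-].
by rewrite pairingZl ler_wpM2l //; apply: mP; exists x.
Qed.

(** Every point of [P] bounds the minimum from above, so one witness [q] per [nu], not necessarily a
    minimiser, is enough. *)
Lemma Fine_interior_dilate (R : realType) (d : nat) (P : set 'rV[R]_d)
  (lambda : R) (x : 'rV[R]_d) : compact P -> 0 <= lambda ->
  (forall nu : 'cV[int]_d, nu != 0 ->
    exists2 q, P q & lambda * pairing q (toNR R nu) + 1 <= pairing x (toNR R nu)) ->
  Fine_interior (dilate lambda P) x.
Proof.
move=> cP l0 H nu nu0; have [q Pq qle] := H nu nu0.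
apply: le_trans qle; rewrite lerD2r -pairingZl; apply: Min_le.
  exact: dilate_pairing_has_lbound.
by exists q.
Qed.

(** * Primitive lattice vectors *)

Lemma exists_coord_neq0 (d : nat) (nu : 'cV[int]_d) :
  nu != 0 -> exists j, nu j 0 != 0.
Proof.
move=> nu0; apply/not_existsP => H; case/eqP: nu0; apply/colP => j.
by rewrite mxE; apply/eqP/negPn/negP; apply: H.
Qed.

(** Bezout: [g] is the least positive value of [nu] on the lattice, and it divides every coordinate
    by Euclidean division. *)
Lemma exists_primitive (d : nat) (nu : 'cV[int]_d) : nu != 0 ->
  exists (g : int) (nu1 : 'cV[int]_d) (u : 'rV[int]_d),
    [/\ 0 < g, nu = g *: nu1 & (u *m nu1) 0 0 = 1].
Proof.
move=> nu0.
pose Q (n : nat) :=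
  `[< (0 < n)%N /\ exists u : 'rV[int]_d, (u *m nu) 0 0 = n%:Z >].
have exQ : exists n, Q n.
  have [j nuj] := exists_coord_neq0 _ _ nu0.
  exists `|nu j 0%R|%N; apply/asboolP; split; first by rewrite absz_gt0.
  exists ((-1) ^+ (nu j 0 < 0)%R *: delta_mx 0 j).
  by rewrite -scalemxAl -rowE !mxE -normrEsign abszE.
case: (ex_minnP exQ) => g /asboolP [g0 [u ug]] gmin.
have gE (j : 'I_d) : nu j 0 = (nu j 0%R %/ g)%Z * g%:Z.
  have := divz_eq (nu j 0%R) g; set q := (_ %/ _)%Z => E.
  rewrite {1}E; suff -> : (nu j 0%R %% g)%Z = 0 by rewrite addr0.
  have r0 : 0 <= (nu j 0%R %% g)%Z by apply: modz_ge0; rewrite gt_eqF.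
  have rg : (nu j 0%R %% g)%Z < g by apply: ltz_pmod.
  apply/eqP/negPn/negP => rn0.
  (* The remainder is again a value of [nu], at [delta_mx 0 j - q *: u]; if nonzero it would be
     positive and below the minimum [g]. *)
  have : Q `|(nu j 0%R %% g)%Z|%N.
    apply/asboolP; split; first by rewrite absz_gt0.
    exists (delta_mx 0 j - q *: u).
    have -> : ((delta_mx 0 j - q *: u) *m nu) 0 0 =
        nu j 0 - q * (u *m nu) 0 0.
      by rewrite mulmxBl -scalemxAl -rowE !mxE.
    by rewrite ug gez0_abs // {1}E; ring.
  move/gmin; rewrite -lez_nat gez0_abs // => /(lt_le_trans rg).
  by rewrite ltxx.
exists g, (\col_j (nu j 0%R %/ g)%Z), u; split => //.
  by apply/colP => j; rewrite !mxE {1}gE mulrC.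
have gn0 : g%:Z != 0 by rewrite gt_eqF.
apply: (mulfI gn0); rewrite mulr1 -[RHS]ug.
rewrite !mxE mulr_sumr; apply: eq_bigr => j _.
by rewrite mxE [in RHS]gE mulrCA [X in _ * X]mulrC.
Qed.

(** * Systems of half-spaces *)

Lemma irredundant_description (R : realType) (d s : nat)
  (nu : 'I_s -> 'cV[int]_d) (delta : 'I_s -> R) :
  exists (s' : nat) (nu' : 'I_s' -> 'cV[int]_d) (delta' : 'I_s' -> R),
    [set x | forall i, delta i <= pairing x (toNR R (nu i))] =
    [set x | forall i, delta' i <= pairing x (toNR R (nu' i))] /\
    forall i, exists y,
      (forall j, j != i -> delta' j <= pairing y (toNR R (nu' j))) /\
      pairing y (toNR R (nu' i)) < delta' i.
Proof.
elim: s nu delta => [|s IH] nu delta.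
  by exists 0%N, nu, delta; split => // -[].
have [irr|/existsNP [i red]] := pselect (forall i, exists y,
    (forall j, j != i -> delta j <= pairing y (toNR R (nu j))) /\
    pairing y (toNR R (nu i)) < delta i).
  by exists s.+1, nu, delta.
have [s' [nu' [delta' [E irr]]]] := IH (nu \o lift i) (delta \o lift i).
exists s', nu', delta'; split => //; rewrite -E.
apply/seteqP; split => x /= H j; first exact: H.
have Hn k : k != i -> delta k <= pairing x (toNR R (nu k)).
  case: (unliftP i k) => [k' ->|->]; last by rewrite eqxx.
  by move=> _; apply: H.
have [->|] := eqVneq j i; last exact: Hn.
by rewrite leNgt; apply/negP => lt; apply: red; exists x.
Qed.

(** Otherwise the form is constant on [P], hence on its affine hull, the whole space, which forces
    [y = 0]. *)
Lemma full_dimensional_strict (R : realType) (d : nat) (P : set 'rV[R]_d)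
  (y : 'cV[R]_d) (delta : R) : full_dimensional P -> y != 0 ->
  (forall x, P x -> delta <= pairing x y) ->
  exists2 x, P x & delta < pairing x y.
Proof.
move=> hdim y0 hP; apply: contrapT => H.
have P_eq x : P x -> pairing x y = delta.
  move=> Px; apply/eqP; rewrite eq_le hP // andbT leNgt; apply/negP => lt.
  by apply: H; exists x.
have all_eq z : pairing z y = delta.
  have : affine_hull P z by rewrite hdim.
  move=> [n [c [p [Pp c1 ->]]]]; rewrite pairing_sumZl.
  rewrite (eq_bigr (fun i => c i * delta)) => [|i _].
    by rewrite -mulr_suml c1 mul1r.
  by rewrite P_eq.
case/eqP: y0; apply/colP => j; rewrite [RHS]mxE.
have := all_eq 0; rewrite /pairing mul0mx mxE => d0.
by have := all_eq (delta_mx 0 j); rewrite /pairing -rowE mxE -d0.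
Qed.

Lemma full_dimensional_nonempty (R : realType) (d : nat) (P : set 'rV[R]_d) :
  full_dimensional P -> P !=set0.
Proof.
move=> hdim; have : affine_hull P 0 by rewrite hdim.
case=> -[|n] [c [p [Pp c1 _]]]; last by exists (p ord0).
by move: c1; rewrite big_ord0 => /eqP; rewrite eq_sym oner_eq0.
Qed.

Lemma full_dimensional_interior (R : realType) (d s : nat)
  (y : 'I_s -> 'cV[R]_d) (delta : 'I_s -> R) :
  full_dimensional [set x | forall i, delta i <= pairing x (y i)] ->
  (forall i, y i != 0) ->
  exists x, forall i, delta i < pairing x (y i).
Proof.
set P := [set x | _] => hdim y0.
suff [x _ H] : exists2 x, P x &
    forall i, i \in enum 'I_s -> delta i < pairing x (y i).
  by exists x => i; apply: H; rewrite mem_enum.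
(* The midpoint of two points of [P] is strict wherever one of them is, so strictness is gained one
   inequality at a time. *)
elim: (enum 'I_s) => [|i r [x Px IH]].
  by have [x Px] := full_dimensional_nonempty _ _ _ hdim; exists x.
have [x' Px' lt] : exists2 x', P x' & delta i < pairing x' (y i).
  by apply: full_dimensional_strict => // z; apply.
have mid j : pairing (2^-1 *: (x + x')) (y j) =
    2^-1 * pairing x (y j) + 2^-1 * pairing x' (y j).
  by rewrite pairingZl pairingDl mulrDr.
exists (2^-1 *: (x + x')) => j; rewrite mid; have := Px j; have := Px' j.
  by move=> /=; lra.
rewrite inE => le1 le2 /predU1P [E|/IH]; last lra.
by move: lt; rewrite -E; lra.
Qed.

(** A slack inequality survives a short step in any direction; a tight one survives if [v] does not
    decrease it. *)
Lemma near_halfspaces (R : realType) (d s : nat) (y : 'I_s -> 'cV[R]_d)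
  (delta : 'I_s -> R) (p v : 'rV[R]_d) :
  (forall i, delta i <= pairing p (y i)) ->
  (forall i, delta i < pairing p (y i) \/ 0 <= pairing v (y i)) ->
  \forall e \near 0^'+, forall i, delta i <= pairing (p + e *: v) (y i).
Proof.
move=> Pp H; apply: filter_forall => i.
have [v0|v0] := leP 0 (pairing v (y i)).
  near=> e; have e0 : 0 < e by [].
  rewrite pairingDl pairingZl; have := Pp i.
  by have := mulr_ge0 (ltW e0) v0; lra.
have lt : delta i < pairing p (y i) by case: (H i) => //; rewrite leNgt v0.
(* The step length that uses up the slack: slack divided by rate of decrease. *)
have c0 : 0 < (pairing p (y i) - delta i) / - pairing v (y i).
  by rewrite divr_gt0 ?subr_gt0 ?oppr_gt0.
near=> e.
have : e <= (pairing p (y i) - delta i) / - pairing v (y i).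
  by near: e; apply: nbhs_right_le.
rewrite ler_pdivlMr ?oppr_gt0 // pairingDl pairingZl; lra.
Unshelve. all: by end_near. Qed.

(** * Fine interiors and hulls of large dilates *)

Lemma sign_mul_eq_opp_norm (m : int) : exists b : bool, (-1) ^+ b * m = - `|m|.
Proof. by exists (~~ (m < 0))%R; rewrite signrN mulNr -normrEsign. Qed.

Lemma dilate_Fine_interior_nonempty (R : realType) (d s : nat)
  (y : 'I_s -> 'cV[R]_d) (delta : 'I_s -> R) (p : 'rV[R]_d) :
  let P := [set x | forall i, delta i <= pairing x (y i)] in
  compact P -> (forall i, delta i < pairing p (y i)) ->
  \forall lambda \near +oo, Fine_interior (dilate lambda P) !=set0.
Proof.
move=> P cP pin.
(* Any nonzero [nu] takes a value at most -1 on one of these signed unit vectors, so finitely many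
   directions treat all [nu]. *)
pose v (jb : 'I_d * bool) : 'rV[int]_d := (-1) ^+ jb.2 *: delta_mx 0 jb.1.
have [e [e0 Pe]] : exists e : R, 0 < e /\
    forall jb, P (p + e *: map_mx intr (v jb)).
  near (0 : R)^'+ => e; exists e; split; first by [].
  near: e; apply: filter_forall => jb; apply: near_halfspaces => i.
    exact: ltW.
  by left.
near=> lambda.
have l0 : 0 <= lambda by near: lambda; apply: nbhs_pinfty_ge; rewrite num_real.
have le1 : 1 <= lambda * e.
  rewrite -(ler_pdivrMr _ _ e0); near: lambda.
  by apply: nbhs_pinfty_ge; rewrite num_real.
exists (lambda *: p); apply: Fine_interior_dilate => // nu nu0.
have [j nuj] := exists_coord_neq0 _ _ nu0.
have [b bE] := sign_mul_eq_opp_norm (nu j 0).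
exists (p + e *: map_mx intr (v (j, b))); first exact: Pe.
rewrite pairingDl !pairingZl pairing_int -scalemxAl -rowE !mxE /= bE.
rewrite mulrDr -addrA gerDl mulrA rmorphN /=.
have : 1 <= (`|nu j 0|%:~R : R).
  by rewrite -[1]/(1%:~R) ler_int -gtz0_ge1 normr_gt0.
set m := (_%:~R) => m1.
have : lambda * e <= lambda * e * m by rewrite ler_peMr //; lra.
by lra.
Unshelve. all: by end_near. Qed.

Lemma canonical_hull_facet_le (R : realType) (d s : nat)
  (nu : 'I_s -> 'cV[int]_d) (delta : 'I_s -> R) (p : 'rV[R]_d) (i : 'I_s) :
  let P := [set x | forall i, delta i <= pairing x (toNR R (nu i))] in
  compact P -> nu i != 0 ->
  pairing p (toNR R (nu i)) = delta i ->
  (forall j, j != i -> delta j < pairing p (toNR R (nu j))) ->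
  \forall lambda \near +oo, forall x, canonical_hull (dilate lambda P) x ->
    lambda * delta i <= pairing x (toNR R (nu i)).
Proof.
move=> P cP nui0 pi pj.
have Pp : P p.
  by move=> j; have [->|/pj/ltW//] := eqVneq j i; rewrite pi.
(* [nu i] may fail to be primitive; a lattice vector of pairing 1 exists only for its primitive part
   [nu1]. *)
have [g [nu1 [u [g0 nuE u1]]]] := exists_primitive _ _ nui0.
have toE : toNR R (nu i) = g%:~R *: toNR R nu1.
  by rewrite nuE /toNR; apply/colP => j; rewrite !mxE rmorphM.
have gR0 : 0 < (g%:~R : R) by rewrite ltr0z.
have nu10 : nu1 != 0 by apply: contraNneq nui0 => E; rewrite nuE E scaler0.
(* [delta_mx 0 j - nu1 j 0 *: u] is parallel to the facet and [u] points
   inwards, so a short step from [p] along [v jb] stays in [P]. *)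
pose v (jb : 'I_d * bool) : 'rV[int]_d :=
  u + (-1) ^+ jb.2 *: (delta_mx 0 jb.1 - nu1 jb.1 0 *: u).
have vE jb (mu : 'cV[int]_d) : (v jb *m mu) 0 0 =
    (u *m mu) 0 0 + (-1) ^+ jb.2 * (mu jb.1 0 - nu1 jb.1 0 * (u *m mu) 0 0).
  rewrite /v mulmxDl -scalemxAl mulmxBl -scalemxAl -rowE.
  by rewrite [LHS]mxE; congr (_ + _); rewrite !mxE.
have [e [e0 Pe]] : exists e : R, 0 < e /\
    forall jb, P (p + e *: map_mx intr (v jb)).
  near (0 : R)^'+ => e; exists e; split; first by [].
  near: e; apply: filter_forall => jb; apply: near_halfspaces => // j.
  have [->|/pj] := eqVneq j i; last by left.
  right; rewrite toE pairingZr pairing_int vE u1 mulr1 subrr mulr0 addr0.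
  by rewrite mulr1 ltW.
near=> lambda => x hx.
have l0 : 0 <= lambda by near: lambda; apply: nbhs_pinfty_ge; rewrite num_real.
(* The constant 2 is forced by the case where [u] and [v jb] both pair to -1 with [mu]: there
   [- (lambda * e) + 1 <= -1] is needed. *)
have le2 : 2 <= lambda * e.
  rewrite -(ler_pdivrMr _ _ e0); near: lambda.
  by apply: nbhs_pinfty_ge; rewrite num_real.
have MinE : Min (dilate lambda P) (toNR R nu1) = lambda * pairing p (toNR R nu1).
  rewrite -pairingZl; apply: Min_attained; first by exists p.
  move=> _ [z Pz <-]; rewrite !pairingZl ler_wpM2l //.
  by rewrite -(ler_pM2l gR0) -!pairingZr -toE pi; apply: Pz.
pose c := lambda *: p + map_mx intr u.
have cE mu : pairing c (toNR R mu) =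
    lambda * pairing p (toNR R mu) + ((u *m mu) 0 0)%:~R.
  by rewrite pairingDl pairingZl pairing_int.
have Fc : Fine_interior (dilate lambda P) c.
  apply: Fine_interior_dilate => // mu mu0; rewrite cE.
  set k := (u *m mu) 0 0.
  have [k1|k0] := leP 1 k.
    by exists p => //; rewrite lerD2l -[1]/(1%:~R) ler_int.
  have [j muj] := exists_coord_neq0 _ _ mu0.
  have [b bE] := sign_mul_eq_opp_norm (mu j 0 - nu1 j 0 * k).
  exists (p + e *: map_mx intr (v (j, b))); first exact: Pe.
  rewrite pairingDl pairingZl pairing_int vE /= bE mulrDr -addrA lerD2l mulrA.
  (* If [k = 0] the norm is that of [mu j 0], which is nonzero; otherwise already [k <= -1]. *)
  have km : k - `|mu j 0 - nu1 j 0 * k| <= -1.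
    have [kz|kn] := eqVneq k 0; last by lia.
    by rewrite kz mulr0 subr0; lia.
  move: km; set m := `|_| => km.
  have kle : k - 2 * m + 1 <= 0 by rewrite /m in km *; lia.
  have kR : (k - m)%:~R <= -1 :> R by rewrite -[-1]/((-1)%:~R) ler_int.
  have kR' : 2 * (k - m)%:~R + 1 <= k%:~R :> R.
    rewrite -[2]/(2%:~R) -[1]/(1%:~R) -intrM -intrD ler_int; lia.
  have : lambda * e * (k - m)%:~R <= 2 * (k - m)%:~R.
    by apply: ler_wnM2r => //; lra.
  lra.
have supp : Fine_support (dilate lambda P) nu1.
  split=> //; have cval : pairing c (toNR R nu1) =
      Min (dilate lambda P) (toNR R nu1) + 1 by rewrite cE MinE u1.
  (* The defining inequality of the Fine interior for [nu1] is an equality at [c], so [c] is a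
     minimiser. *)
  by rewrite -cval; apply: Min_attained => // z; rewrite cval; apply.
have := hx _ supp; rewrite MinE toE pairingZr -pi toE pairingZr mulrCA.
by rewrite ler_pM2l.
Unshelve. all: by end_near. Qed.

(** * Facet points and the conclusion *)

Lemma facet_point (R : realType) (d s : nat) (y : 'I_s -> 'cV[R]_d)
  (delta : 'I_s -> R) (p q : 'rV[R]_d) (i : 'I_s) :
  (forall j, delta j < pairing p (y j)) ->
  (forall j, j != i -> delta j <= pairing q (y j)) ->
  pairing q (y i) < delta i ->
  exists2 z, pairing z (y i) = delta i &
    forall j, j != i -> delta j < pairing z (y j).
Proof.
move=> hp hq qi; set a := pairing p (y i); set b := pairing q (y i).
have ai : delta i < a := hp i.
have ab0 : 0 < a - b by rewrite /b; lra.
(* Solves [(1 - t) * a + t * b = delta i]. As [t < 1], the strict inequalities at [p] carry over. *)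
pose t := (a - delta i) / (a - b).
have tE : t * (a - b) = a - delta i by rewrite divfK // gt_eqF.
have t0 : 0 < t by rewrite divr_gt0 // subr_gt0.
have t1 : t < 1 by rewrite ltr_pdivrMr // mul1r /b; lra.
exists ((1 - t) *: p + t *: q) => [|j ji]; rewrite pairingDl !pairingZl.
  by rewrite -/a -/b; lra.
have : (1 - t) * delta j < (1 - t) * pairing p (y j).
  by rewrite ltr_pM2l ?hp // subr_gt0.
have : t * delta j <= t * pairing q (y j) by rewrite ler_pM2l ?hq.
lra.
Qed.

Theorem corollary4p15 (R : realType) (d : nat) (P : set 'rV[R]_d)
  (hP : generalized_Delzant P) (hdim : full_dimensional P) :
  exists2 lambda0 : R, 0 < lambda0 &
    forall lambda : R, lambda0 <= lambda ->
      canonically_closed (dilate lambda P).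
Proof.
case: hP => cP [s0 [nu0 [delta0 PE]]].
have [s [nu [delta [E irr]]]] := irredundant_description _ _ _ nu0 delta0.
rewrite {}E in PE; rewrite {}PE in cP hdim *; set P' := [set x | _] in cP hdim *.
have [x0 Px0] := full_dimensional_nonempty _ _ _ hdim.
(* A zero normal pairs to 0 everywhere, so its inequality could not hold at [x0] and fail at [y]. *)
have nuN i : toNR R (nu i) != 0.
  apply/eqP => E; have [y [_]] := irr i; have := Px0 i.
  by rewrite /= E /pairing !mulmx0 mxE; lra.
have [p pin] := full_dimensional_interior _ _ _ _ _ hdim nuN.
have hull i : \forall lambda \near +oo,
    forall x, canonical_hull (dilate lambda P') x ->
    lambda * delta i <= pairing x (toNR R (nu i)).
  have [q [qj qi]] := irr i.
  have [z zi zj] := facet_point _ _ _ (fun j => toNR R (nu j)) _ _ _ _ pin qj qi.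
  apply: canonical_hull_facet_le zi zj => //.
  by apply: contraNneq (nuN i) => ->; rewrite /toNR map_mx0.
have closed : \forall lambda \near +oo, canonically_closed (dilate lambda P').
  have hull' := filter_forall _ hull.
  have ne := dilate_Fine_interior_nonempty _ _ _ _ _ _ cP pin.
  near=> lambda.
  have l0 : 0 < lambda by near: lambda; apply: nbhs_pinfty_gt; rewrite num_real.
  have hullP : forall i x, canonical_hull (dilate lambda P') x ->
    lambda * delta i <= pairing x (toNR R (nu i)).
    by near: lambda; exact: hull'.
  split; first by near: lambda.
  apply/seteqP; split => x hx.
    exists (lambda^-1 *: x); last by rewrite scalerA mulfV ?gt_eqF // scale1r.
    move=> i; rewrite pairingZl mulrC ler_pdivlMr // mulrC.
    exact: hullP.
  move=> mu _; apply: Min_le => //.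
  by apply: dilate_pairing_has_lbound => //; apply: ltW.
(* [HM] applies strictly above [M], which may be negative; this threshold is positive and exceeds
   [M]. *)
case: closed => M [_ HM]; exists (Num.max M 0 + 1).
  by rewrite ltr_pwDr // le_max lexx orbT.
move=> lambda lel; apply: HM; apply: lt_le_trans lel.
by rewrite ltr_pwDr // le_max lexx.
Unshelve. all: by end_near. Qed.
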